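(* Let $\gamma\in\{\beta,\mu,\mu',\rho,\theta\}$ and let $t,v$ be both $\lambda\mu$-terms or both $\lambda\mu$-commands. If $t\to_\gamma v$ in one step in the $\lambda\mu$-calculus, then there exists a $\bar\lambda\mu\tilde\mu$-expression $u$ such that $t^\dag \overset{*}{\to} u$ and $v^\dag \overset{*}{\leadsto} u$ in the $\bar\lambda\mu\tilde\mu$-calculus.
   Context: Throughout, $x,y,\dots$ range over $\lambda$-variables and $\alpha,\beta,\delta,\dots$ over $\mu$-variables; $\lambda,\mu,\tilde\mu$ are binders, expressions are identified up to $\alpha$-equivalence and all substitutions are capture-avoiding. All one-step reductions may be applied to any subexpression (compatible closure of the displayed rules). **$\lambda\mu$-calculus.** Terms $t ::= x \mid \lambda x.t \mid (t)\,t \mid \mu\alpha.c$; commands $c ::= [\alpha]\,t$; contexts $e ::= \alpha \mid \beta(t) \mid t\cdot e$ (in $\beta(t)$, $\beta$ is any $\mu$-variable). For a context $e$ and term $t$ the command $e\{t\}$ is: $\alpha\{t\}=[\alpha]\,t$; $\beta(u)\{t\}=[\beta]\,(u)\,t$; $(u\cdot h)\{t\}=h\{(t)\,u\}$. For a $\mu$-variable $\alpha$ and context $e$, $t[\alpha\gets e]$ and $c[\alpha\gets e]$ are defined by structural recursion, commuting with all constructors except $([\alpha]\,t)[\alpha\gets e]=e\{t[\alpha\gets e]\}$ (and $([\beta]\,t)[\alpha\gets e]=[\beta]\,t[\alpha\gets e]$ for $\beta\neq\alpha$). Rules: - $\beta$: $(\lambda x.u)\,t\to u[x\gets t]$; -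 $\mu$: $(\mu\alpha.c)\,t\to\mu\alpha.\,c[\alpha\gets t\cdot\alpha]$; - $\mu'$: $(t)\,\mu\alpha.c\to\mu\alpha.\,c[\alpha\gets\alpha(t)]$; - $\rho$: $[\beta]\,\mu\alpha.c\to c[\alpha\gets\beta]$; - $\theta$: $\mu\delta.[\delta]\,t\to t$ if $\delta$ is not free in $t$. In $\mu$ and $\mu'$ the bound $\alpha$ is chosen not free in $t$. **$\bar\lambda\mu\tilde\mu$-calculus.** Terms $t ::= x\mid\lambda x.t\mid\mu\alpha.c$; commands $c ::= \langle t\,|\,e\rangle$; contexts $e ::= \alpha\mid t\cdot e\mid\tilde\mu x.c$; an expression is a term, command or context. Rules: - $\beta$: $\langle\lambda x.u\,|\,t\cdot e\rangle\to\langle t\,|\,\tilde\mu x.\langle u\,|\,e\rangle\rangle$; - $\mu$: $\langle\mu\alpha.c\,|\,e\rangle\to c[\alpha\gets e]$; - $\tilde\mu$: $\langle t\,|\,\tilde\mu x.c\rangle\to c[x\gets t]$; - $\theta$: $\mu\delta.\langle t\,|\,\delta\rangle\to t$ if $\delta$ is not free in $t$. $\overset{*}{\to}$ is the reflexive-transitive closure of the union of these one-step reductions. A step is linear if it is a $\beta$-step, a $\theta$-step, a $\mu$-step in which $e$ is a $\mu$-variable or $\alpha$ has exactly one free occurrence in $c$, or a $\tilde\mu$-step in which $t$ is a $\lambda$-variable or $x$ has exactly one free occurrence in $c$. $\overset{*}{\leadsto}$ is the reflexive-transitive closure of linear one-step reduction. **Translation $(\cdot)^\dag$ from $\lambda\mu$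 to $\bar\lambda\mu\tilde\mu$.** $x^\dag=x$; $(\lambda x.u)^\dag=\lambda x.u^\dag$; $((u)\,v)^\dag=\mu\beta.\langle v^\dag\,|\,\tilde\mu y.\langle u^\dag\,|\,y\cdot\beta\rangle\rangle$ with $y,\beta$ not free in $u,v$; $(\mu\alpha.c)^\dag=\mu\alpha.c^\dag$; $([\alpha]\,t)^\dag=\langle t^\dag\,|\,\alpha\rangle$; on contexts $\alpha^\dag=\alpha$, $(\beta(t))^\dag=\tilde\mu y.\langle t^\dag\,|\,y\cdot\beta\rangle$ with $y$ not free in $t$, $(t\cdot h)^\dag=t^\dag\cdot h^\dag$. *)

(* Defs.v *)
From Stdlib Require Export Relations.Relation_Operators.

(* Expressions modulo alpha-equivalence are represented by de Bruijn indices,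
   with two independent index spaces: lambda-variables (bound by lambda and
   mu-tilde) and mu-variables (bound by mu).  A free variable is an index
   exceeding the number of enclosing binders of its kind.  In both calculi
   renamings and substitutions are simultaneous and act on the two kinds of
   variables at once; a substitution for one variable is the instance
   [scons _ _], which sends index 0 to the given expression. *)

Definition scons {A : Type} (a : A) (f : nat -> A) (n : nat) : A :=
  match n with 0 => a | S m => f m end.

Definition idn (n : nat) : nat := n.

Definition up_ren (f : nat -> nat) : nat -> nat := scons 0 (fun n => S (f n)).

(** * The lambda-mu-calculus *)

Inductive ltm : Type :=
| LVar (x : nat)
| LLam (t : ltm)
| LApp (t u : ltm)
| LMu (c : lcmd)
with lcmd : Type :=
| LName (a : nat) (t : ltm).      (* [a] t *)

Inductive lctx : Type :=
| LCoVar (a : nat)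
| LArg (b : nat) (t : ltm)        (* b(t) *)
| LPush (t : ltm) (e : lctx).     (* t . e *)

Fixpoint lren_tm (f g : nat -> nat) (t : ltm) : ltm :=
  match t with
  | LVar x => LVar (f x)
  | LLam t => LLam (lren_tm (up_ren f) g t)
  | LApp t u => LApp (lren_tm f g t) (lren_tm f g u)
  | LMu c => LMu (lren_cmd f (up_ren g) c)
  end
with lren_cmd (f g : nat -> nat) (c : lcmd) : lcmd :=
  match c with
  | LName a t => LName (g a) (lren_tm f g t)
  end.

Fixpoint lren_ctx (f g : nat -> nat) (e : lctx) : lctx :=
  match e with
  | LCoVar a => LCoVar (g a)
  | LArg b t => LArg (g b) (lren_tm f g t)
  | LPush t e => LPush (lren_tm f g t) (lren_ctx f g e)
  end.

(* The command e{t}. *)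
Fixpoint lplug (e : lctx) (t : ltm) : lcmd :=
  match e with
  | LCoVar a => LName a t
  | LArg b u => LName b (LApp u t)
  | LPush u h => lplug h (LApp t u)
  end.

(* On a mu-variable that is not being substituted, [r] is [LCoVar b], and
   [lplug (LCoVar b) t] is [LName b t]. *)
Fixpoint lsubst_tm (s : nat -> ltm) (r : nat -> lctx) (t : ltm) : ltm :=
  match t with
  | LVar x => s x
  | LLam t =>
      LLam (lsubst_tm (scons (LVar 0) (fun x => lren_tm S idn (s x)))
                      (fun a => lren_ctx S idn (r a)) t)
  | LApp t u => LApp (lsubst_tm s r t) (lsubst_tm s r u)
  | LMu c =>
      LMu (lsubst_cmd (fun x => lren_tm idn S (s x))
                      (scons (LCoVar 0) (fun a => lren_ctx idn S (r a))) c)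
  end
with lsubst_cmd (s : nat -> ltm) (r : nat -> lctx) (c : lcmd) : lcmd :=
  match c with
  | LName a t => lplug (r a) (lsubst_tm s r t)
  end.

Inductive rule : Type := Rbeta | Rmu | Rmu' | Rrho | Rtheta.

(* In [Rmu] and [Rmu'] the binder remains, so index 0 is replaced by a context
   that again mentions 0 and the other mu-variables are kept unchanged.  In
   [Rtheta], [lren_tm idn S t] is exactly a term in which the mu-variable 0 is
   not free. *)
Inductive lroot_tm : rule -> ltm -> ltm -> Prop :=
| lroot_beta u t :
    lroot_tm Rbeta (LApp (LLam u) t) (lsubst_tm (scons t LVar) LCoVar u)
| lroot_mu c t :
    lroot_tm Rmu (LApp (LMu c) t)
      (LMu (lsubst_cmd LVar
              (scons (LPush (lren_tm idn S t) (LCoVar 0))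
                     (fun a => LCoVar (S a))) c))
| lroot_mu' t c :
    lroot_tm Rmu' (LApp t (LMu c))
      (LMu (lsubst_cmd LVar
              (scons (LArg 0 (lren_tm idn S t))
                     (fun a => LCoVar (S a))) c))
| lroot_theta t :
    lroot_tm Rtheta (LMu (LName 0 (lren_tm idn S t))) t.

Inductive lroot_cmd : rule -> lcmd -> lcmd -> Prop :=
| lroot_rho b c :
    lroot_cmd Rrho (LName b (LMu c))
      (lsubst_cmd LVar (scons (LCoVar b) LCoVar) c).

Inductive lred_tm (g : rule) : ltm -> ltm -> Prop :=
| lred_tm_root t t' : lroot_tm g t t' -> lred_tm g t t'
| lred_lam t t' : lred_tm g t t' -> lred_tm g (LLam t) (LLam t')
| lred_appl t t' u : lred_tm g t t' -> lred_tm g (LApp t u) (LApp t' u)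
| lred_appr t u u' : lred_tm g u u' -> lred_tm g (LApp t u) (LApp t u')
| lred_mu c c' : lred_cmd g c c' -> lred_tm g (LMu c) (LMu c')
with lred_cmd (g : rule) : lcmd -> lcmd -> Prop :=
| lred_cmd_root c c' : lroot_cmd g c c' -> lred_cmd g c c'
| lred_name a t t' : lred_tm g t t' -> lred_cmd g (LName a t) (LName a t').

(** * The lambda-bar-mu-mu-tilde-calculus *)

Inductive tm : Type :=
| Var (x : nat)
| Lam (t : tm)
| Mu (c : cmd)
with cmd : Type :=
| Cut (t : tm) (e : ctx)          (* < t | e > *)
with ctx : Type :=
| CoVar (a : nat)
| Push (t : tm) (e : ctx)         (* t . e *)
| TMu (c : cmd).                  (* mu-tilde x. c *)

Fixpoint ren_tm (f g : nat -> nat) (t : tm) : tm :=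
  match t with
  | Var x => Var (f x)
  | Lam t => Lam (ren_tm (up_ren f) g t)
  | Mu c => Mu (ren_cmd f (up_ren g) c)
  end
with ren_cmd (f g : nat -> nat) (c : cmd) : cmd :=
  match c with
  | Cut t e => Cut (ren_tm f g t) (ren_ctx f g e)
  end
with ren_ctx (f g : nat -> nat) (e : ctx) : ctx :=
  match e with
  | CoVar a => CoVar (g a)
  | Push t e => Push (ren_tm f g t) (ren_ctx f g e)
  | TMu c => TMu (ren_cmd (up_ren f) g c)
  end.

Fixpoint subst_tm (s : nat -> tm) (r : nat -> ctx) (t : tm) : tm :=
  match t with
  | Var x => s x
  | Lam t =>
      Lam (subst_tm (scons (Var 0) (fun x => ren_tm S idn (s x)))
                    (fun a => ren_ctx S idn (r a)) t)
  | Mu c =>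
      Mu (subst_cmd (fun x => ren_tm idn S (s x))
                    (scons (CoVar 0) (fun a => ren_ctx idn S (r a))) c)
  end
with subst_cmd (s : nat -> tm) (r : nat -> ctx) (c : cmd) : cmd :=
  match c with
  | Cut t e => Cut (subst_tm s r t) (subst_ctx s r e)
  end
with subst_ctx (s : nat -> tm) (r : nat -> ctx) (e : ctx) : ctx :=
  match e with
  | CoVar a => r a
  | Push t e => Push (subst_tm s r t) (subst_ctx s r e)
  | TMu c =>
      TMu (subst_cmd (scons (Var 0) (fun x => ren_tm S idn (s x)))
                     (fun a => ren_ctx S idn (r a)) c)
  end.

(* Number of free occurrences of the lambda-variable with index n. *)
Fixpoint occ_var_tm (n : nat) (t : tm) : nat :=
  match t with
  | Var x => if Nat.eqb x n then 1 else 0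
  | Lam t => occ_var_tm (S n) t
  | Mu c => occ_var_cmd n c
  end
with occ_var_cmd (n : nat) (c : cmd) : nat :=
  match c with
  | Cut t e => occ_var_tm n t + occ_var_ctx n e
  end
with occ_var_ctx (n : nat) (e : ctx) : nat :=
  match e with
  | CoVar _ => 0
  | Push t e => occ_var_tm n t + occ_var_ctx n e
  | TMu c => occ_var_cmd (S n) c
  end.

(* Number of free occurrences of the mu-variable with index n. *)
Fixpoint occ_covar_tm (n : nat) (t : tm) : nat :=
  match t with
  | Var _ => 0
  | Lam t => occ_covar_tm n t
  | Mu c => occ_covar_cmd (S n) c
  end
with occ_covar_cmd (n : nat) (c : cmd) : nat :=
  match c with
  | Cut t e => occ_covar_tm n t + occ_covar_ctx n e
  end
with occ_covar_ctx (n : nat) (e : ctx) : nat :=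
  match e with
  | CoVar a => if Nat.eqb a n then 1 else 0
  | Push t e => occ_covar_tm n t + occ_covar_ctx n e
  | TMu c => occ_covar_cmd n c
  end.

Inductive root_tm : tm -> tm -> Prop :=
| root_theta t : root_tm (Mu (Cut (ren_tm idn S t) (CoVar 0))) t.

Inductive root_cmd : cmd -> cmd -> Prop :=
| root_beta u t e :
    root_cmd (Cut (Lam u) (Push t e))
             (Cut t (TMu (Cut u (ren_ctx S idn e))))
| root_mu c e :
    root_cmd (Cut (Mu c) e) (subst_cmd Var (scons e CoVar) c)
| root_tmu t c :
    root_cmd (Cut t (TMu c)) (subst_cmd (scons t Var) CoVar c).

(* Linear instances of the rules; theta-steps are always linear. *)
Inductive lin_root_cmd : cmd -> cmd -> Prop :=
| lin_root_beta u t e :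
    lin_root_cmd (Cut (Lam u) (Push t e))
                 (Cut t (TMu (Cut u (ren_ctx S idn e))))
| lin_root_mu c e :
    (exists a, e = CoVar a) \/ occ_covar_cmd 0 c = 1 ->
    lin_root_cmd (Cut (Mu c) e) (subst_cmd Var (scons e CoVar) c)
| lin_root_tmu t c :
    (exists x, t = Var x) \/ occ_var_cmd 0 c = 1 ->
    lin_root_cmd (Cut t (TMu c)) (subst_cmd (scons t Var) CoVar c).

(* Closure of root relations RT (on terms) and RC (on commands) under all
   constructors; there is no root rule on contexts. *)
Inductive compat_tm (RT : tm -> tm -> Prop) (RC : cmd -> cmd -> Prop) :
  tm -> tm -> Prop :=
| compat_tm_root t t' : RT t t' -> compat_tm RT RC t t'
| compat_lam t t' : compat_tm RT RC t t' -> compat_tm RT RC (Lam t) (Lam t')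
| compat_mu c c' : compat_cmd RT RC c c' -> compat_tm RT RC (Mu c) (Mu c')
with compat_cmd (RT : tm -> tm -> Prop) (RC : cmd -> cmd -> Prop) :
  cmd -> cmd -> Prop :=
| compat_cmd_root c c' : RC c c' -> compat_cmd RT RC c c'
| compat_cutl t t' e :
    compat_tm RT RC t t' -> compat_cmd RT RC (Cut t e) (Cut t' e)
| compat_cutr t e e' :
    compat_ctx RT RC e e' -> compat_cmd RT RC (Cut t e) (Cut t e')
with compat_ctx (RT : tm -> tm -> Prop) (RC : cmd -> cmd -> Prop) :
  ctx -> ctx -> Prop :=
| compat_pushl t t' e :
    compat_tm RT RC t t' -> compat_ctx RT RC (Push t e) (Push t' e)
| compat_pushr t e e' :
    compat_ctx RT RC e e' -> compat_ctx RT RC (Push t e) (Push t e')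
| compat_tmu c c' : compat_cmd RT RC c c' -> compat_ctx RT RC (TMu c) (TMu c').

(* Reduction and linear reduction preserve the syntactic category, hence one
   relation per category. *)
Definition reds_tm : tm -> tm -> Prop :=
  clos_refl_trans tm (compat_tm root_tm root_cmd).
Definition reds_cmd : cmd -> cmd -> Prop :=
  clos_refl_trans cmd (compat_cmd root_tm root_cmd).

Definition lin_reds_tm : tm -> tm -> Prop :=
  clos_refl_trans tm (compat_tm root_tm lin_root_cmd).
Definition lin_reds_cmd : cmd -> cmd -> Prop :=
  clos_refl_trans cmd (compat_cmd root_tm lin_root_cmd).

(** * The translation *)

(* In the clause for applications v is weakened by the mu-variable beta, and u
   by both beta and the lambda-variable y. *)
Fixpoint dag_tm (t : ltm) : tm :=
  match t with
  | LVar x => Var x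
  | LLam u => Lam (dag_tm u)
  | LApp u v =>
      Mu (Cut (ren_tm idn S (dag_tm v))
              (TMu (Cut (ren_tm S S (dag_tm u)) (Push (Var 0) (CoVar 0)))))
  | LMu c => Mu (dag_cmd c)
  end
with dag_cmd (c : lcmd) : cmd :=
  match c with
  | LName a t => Cut (dag_tm t) (CoVar a)
  end.

Fixpoint dag_ctx (e : lctx) : ctx :=
  match e with
  | LCoVar a => CoVar a
  | LArg b t => TMu (Cut (ren_tm S idn (dag_tm t)) (Push (Var 0) (CoVar b)))
  | LPush t h => Push (dag_tm t) (dag_ctx h)
  end.

(* Main.v *)
Require Import Defs.
From Stdlib Require Import Arith Lia.

(** Write [t^] for the translation of [t].  The translation of an application is
    a mu-abstraction over a cut against a mu-tilde context, so the target
    calculus can postpone the choice between call-by-name and call-by-value, and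
    each source rule is mirrored by a few target steps.  The only mismatch comes
    from mu-substitution: the source replaces a named term [[a] w] by [e{w}],
    which rebuilds ordinary applications, whereas the target puts the context
    [e^] directly in the cut [<w^ | e^>].

    The key fact ([lin_reds_dag_lplug]) is that [(e{w})^] reduces to
    [<w^ | e^>] by linear steps only: the mu- and mu-tilde-binders introduced by
    translating an application bind exactly one occurrence each.  Hence
    [(t[a <- e])^] reduces linearly to [t^[a <- e^]] ([lin_reds_dag_subst]); no
    other discrepancy arises, because [(.)^] commutes with renaming and with
    every other clause of substitution.

    It remains to see that the translation of a redex reduces to the translated
    body with the translated substitution applied:
    - beta: [mu b.<t^ | mu~ y.<lam x.u^ | y.b>>] goes by beta and two mu-tilde
      steps to [mu b.<u^[x <- t^] | b>], then by theta to [u^[x <- t^]];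
    - mu: [mu b.<t^ | mu~ y.<mu a.c^ | y.b>>] goes by mu-tilde and then mu to
      [mu b.c^[a <- t^.b]];
    - mu': [mu b.<mu a.c^ | mu~ y.<t^ | y.b>>] goes by one mu step to
      [mu b.c^[a <- mu~ y.<t^ | y.b>]];
    - rho and theta are single mu and theta steps.
    Closure under source contexts follows since reduction, linear or not, is
    stable under renaming ([compat_ren]), which matters because the translation
    weakens the two subterms of an application. *)

(** * Induction principles *)

Scheme tm_mut := Induction for tm Sort Prop
with cmd_mut := Induction for cmd Sort Prop
with ctx_mut := Induction for ctx Sort Prop.
Combined Scheme expr_ind from tm_mut, cmd_mut, ctx_mut.

Scheme ltm_mut := Induction for ltm Sort Prop
with lcmd_mut := Induction for lcmd Sort Prop.
Combined Scheme lexpr_ind from ltm_mut, lcmd_mut.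

Scheme compat_tm_mut := Minimality for compat_tm Sort Prop
with compat_cmd_mut := Minimality for compat_cmd Sort Prop
with compat_ctx_mut := Minimality for compat_ctx Sort Prop.
Combined Scheme compat_ind from compat_tm_mut, compat_cmd_mut, compat_ctx_mut.

Scheme lred_tm_mut := Minimality for lred_tm Sort Prop
with lred_cmd_mut := Minimality for lred_cmd Sort Prop.
Combined Scheme lred_ind from lred_tm_mut, lred_cmd_mut.

(** * Composition of renamings and substitutions *)

(** In this part the composite renaming or substitution is an extra parameter
    constrained pointwise.  This makes the inductions pass under binders without
    functional extensionality, and lets two different composites be compared by
    exhibiting a common value. *)
Lemma ren_ren :
  (forall t f g f' g' f'' g'',
     (forall x, f' (f x) = f'' x) -> (forall a, g' (g a) = g'' a) ->
     ren_tm f' g' (ren_tm f g t) = ren_tm f'' g'' t) /\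
  (forall c f g f' g' f'' g'',
     (forall x, f' (f x) = f'' x) -> (forall a, g' (g a) = g'' a) ->
     ren_cmd f' g' (ren_cmd f g c) = ren_cmd f'' g'' c) /\
  (forall e f g f' g' f'' g'',
     (forall x, f' (f x) = f'' x) -> (forall a, g' (g a) = g'' a) ->
     ren_ctx f' g' (ren_ctx f g e) = ren_ctx f'' g'' e).
Proof.
  apply expr_ind; intros; simpl; auto; f_equal; auto;
    match goal with IH : _ |- _ => apply IH; auto end;
    intros [|n]; simpl; auto.
Qed.

Lemma ren_tm_comm t f g f' g' k l k' l' :
  (forall x, f' (f x) = k' (k x)) -> (forall a, g' (g a) = l' (l a)) ->
  ren_tm f' g' (ren_tm f g t) = ren_tm k' l' (ren_tm k l t).
Proof.
  intros Hf Hg.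
  rewrite (proj1 ren_ren t f g f' g' _ _ Hf Hg). symmetry.
  now apply ren_ren.
Qed.

Lemma ren_ctx_comm e f g f' g' k l k' l' :
  (forall x, f' (f x) = k' (k x)) -> (forall a, g' (g a) = l' (l a)) ->
  ren_ctx f' g' (ren_ctx f g e) = ren_ctx k' l' (ren_ctx k l e).
Proof.
  intros Hf Hg.
  rewrite (proj2 (proj2 ren_ren) e f g f' g' _ _ Hf Hg). symmetry.
  now apply ren_ren.
Qed.

Lemma subst_ren :
  (forall t f g s r s' r',
     (forall x, s (f x) = s' x) -> (forall a, r (g a) = r' a) ->
     subst_tm s r (ren_tm f g t) = subst_tm s' r' t) /\
  (forall c f g s r s' r',
     (forall x, s (f x) = s' x) -> (forall a, r (g a) = r' a) ->
     subst_cmd s r (ren_cmd f g c) = subst_cmd s' r' c) /\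
  (forall e f g s r s' r',
     (forall x, s (f x) = s' x) -> (forall a, r (g a) = r' a) ->
     subst_ctx s r (ren_ctx f g e) = subst_ctx s' r' e).
Proof.
  apply expr_ind; intros; simpl; auto; f_equal; auto;
    match goal with IH : _ |- _ => apply IH; auto end;
    intros; try match goal with n : nat |- _ => destruct n end;
    simpl; f_equal; auto.
Qed.

Lemma ren_subst :
  (forall t f g s r s' r',
     (forall x, ren_tm f g (s x) = s' x) ->
     (forall a, ren_ctx f g (r a) = r' a) ->
     ren_tm f g (subst_tm s r t) = subst_tm s' r' t) /\
  (forall c f g s r s' r',
     (forall x, ren_tm f g (s x) = s' x) ->
     (forall a, ren_ctx f g (r a) = r' a) ->
     ren_cmd f g (subst_cmd s r c) = subst_cmd s' r' c) /\
  (forall e f g s r s' r',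
     (forall x, ren_tm f g (s x) = s' x) ->
     (forall a, ren_ctx f g (r a) = r' a) ->
     ren_ctx f g (subst_ctx s r e) = subst_ctx s' r' e).
Proof.
  apply expr_ind; intros; simpl; auto; f_equal; auto;
    match goal with IH : _ |- _ => apply IH; auto end;
    intros n; try destruct n; simpl; auto;
    match goal with H : _ |- _ => rewrite <- H end;
    first [apply ren_tm_comm | apply ren_ctx_comm]; reflexivity.
Qed.

(** Substituting in a weakened expression often undoes or adjusts the weakening;
    recognising the result as a renaming dispenses with any composition law for
    two substitutions. *)
Lemma subst_is_ren :
  (forall t s r f g,
     (forall x, s x = Var (f x)) -> (forall a, r a = CoVar (g a)) ->
     subst_tm s r t = ren_tm f g t) /\
  (forall c s r f g,
     (forall x, s x = Var (f x)) -> (forall a, r a = CoVar (g a)) ->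
     subst_cmd s r c = ren_cmd f g c) /\
  (forall e s r f g,
     (forall x, s x = Var (f x)) -> (forall a, r a = CoVar (g a)) ->
     subst_ctx s r e = ren_ctx f g e).
Proof.
  apply expr_ind; intros; simpl; auto; f_equal; auto;
    match goal with IH : _ |- _ => apply IH; auto end;
    intros n; try destruct n; simpl; auto;
    match goal with H : _ |- _ => rewrite H end; reflexivity.
Qed.

Lemma ren_id :
  (forall t f g, (forall x, f x = x) -> (forall a, g a = a) ->
     ren_tm f g t = t) /\
  (forall c f g, (forall x, f x = x) -> (forall a, g a = a) ->
     ren_cmd f g c = c) /\
  (forall e f g, (forall x, f x = x) -> (forall a, g a = a) ->
     ren_ctx f g e = e).
Proof.
  apply expr_ind; intros; simpl; auto; f_equal; auto;
    match goal with IH : _ |- _ => apply IH; auto end;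
    intros [|n]; simpl; auto.
Qed.

Lemma subst_ren_is_ren_tm t f g s r f' g' :
  (forall x, s (f x) = Var (f' x)) -> (forall a, r (g a) = CoVar (g' a)) ->
  subst_tm s r (ren_tm f g t) = ren_tm f' g' t.
Proof.
  intros Hs Hr. rewrite (proj1 subst_ren t f g s r _ _ Hs Hr).
  now apply subst_is_ren.
Qed.

Lemma subst_ren_is_ren_ctx e f g s r f' g' :
  (forall x, s (f x) = Var (f' x)) -> (forall a, r (g a) = CoVar (g' a)) ->
  subst_ctx s r (ren_ctx f g e) = ren_ctx f' g' e.
Proof.
  intros Hs Hr. rewrite (proj2 (proj2 subst_ren) e f g s r _ _ Hs Hr).
  now apply subst_is_ren.
Qed.

Lemma subst_ren_id_tm t f g s r :
  (forall x, s (f x) = Var x) -> (forall a, r (g a) = CoVar a) ->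
  subst_tm s r (ren_tm f g t) = t.
Proof.
  intros Hs Hr. rewrite (subst_ren_is_ren_tm t f g s r idn idn Hs Hr).
  now apply ren_id.
Qed.

Lemma subst_ren_comm_tm t h k s r s' r' :
  (forall x, s' (h x) = ren_tm h k (s x)) ->
  (forall a, r' (k a) = ren_ctx h k (r a)) ->
  subst_tm s' r' (ren_tm h k t) = ren_tm h k (subst_tm s r t).
Proof.
  intros Hs Hr. rewrite (proj1 subst_ren t h k s' r' _ _ Hs Hr).
  symmetry. now apply ren_subst.
Qed.

(** * Occurrences under renaming *)

Lemma up_ren_0 f x : up_ren f x = 0 <-> x = 0.
Proof. destruct x; simpl; lia. Qed.

Lemma up_ren_eq f n m :
  (forall x, f x = n <-> x = m) -> forall x, up_ren f x = S n <-> x = S m.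
Proof. intros H [|x]; simpl; [lia|]. specialize (H x). lia. Qed.

Lemma up_ren_neq f n : (forall x, f x <> n) -> forall x, up_ren f x <> S n.
Proof. intros H [|x]; simpl; [lia|]. specialize (H x). lia. Qed.

Lemma occ_var_ren :
  (forall t f g n m, (forall x, f x = n <-> x = m) ->
     occ_var_tm n (ren_tm f g t) = occ_var_tm m t) /\
  (forall c f g n m, (forall x, f x = n <-> x = m) ->
     occ_var_cmd n (ren_cmd f g c) = occ_var_cmd m c) /\
  (forall e f g n m, (forall x, f x = n <-> x = m) ->
     occ_var_ctx n (ren_ctx f g e) = occ_var_ctx m e).
Proof.
  apply expr_ind; intros; simpl; auto using up_ren_eq.
  destruct (Nat.eqb_spec (f x) n) as [E|E], (Nat.eqb_spec x m) as [E'|E'];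
    auto; apply H in E' || apply H in E; contradiction.
Qed.

Lemma occ_covar_ren :
  (forall t f g n m, (forall a, g a = n <-> a = m) ->
     occ_covar_tm n (ren_tm f g t) = occ_covar_tm m t) /\
  (forall c f g n m, (forall a, g a = n <-> a = m) ->
     occ_covar_cmd n (ren_cmd f g c) = occ_covar_cmd m c) /\
  (forall e f g n m, (forall a, g a = n <-> a = m) ->
     occ_covar_ctx n (ren_ctx f g e) = occ_covar_ctx m e).
Proof.
  apply expr_ind; intros; simpl; auto using up_ren_eq.
  destruct (Nat.eqb_spec (g a) n) as [E|E], (Nat.eqb_spec a m) as [E'|E'];
    auto; apply H in E' || apply H in E; contradiction.
Qed.

Lemma occ_var_fresh :
  (forall t f g n, (forall x, f x <> n) -> occ_var_tm n (ren_tm f g t) = 0) /\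
  (forall c f g n, (forall x, f x <> n) -> occ_var_cmd n (ren_cmd f g c) = 0) /\
  (forall e f g n, (forall x, f x <> n) -> occ_var_ctx n (ren_ctx f g e) = 0).
Proof.
  apply expr_ind; intros; simpl; auto using up_ren_neq.
  - destruct (Nat.eqb_spec (f x) n); auto. now apply H in e.
  - rewrite H, H0; auto using up_ren_neq.
  - rewrite H, H0; auto using up_ren_neq.
Qed.

Lemma occ_covar_fresh :
  (forall t f g n, (forall a, g a <> n) -> occ_covar_tm n (ren_tm f g t) = 0) /\
  (forall c f g n, (forall a, g a <> n) ->
     occ_covar_cmd n (ren_cmd f g c) = 0) /\
  (forall e f g n, (forall a, g a <> n) -> occ_covar_ctx n (ren_ctx f g e) = 0).
Proof.
  apply expr_ind; intros; simpl; auto using up_ren_neq.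
  - rewrite H, H0; auto using up_ren_neq.
  - destruct (Nat.eqb_spec (g a) n); auto. now apply H in e.
  - rewrite H, H0; auto using up_ren_neq.
Qed.

(** * Reduction is stable under renaming and under translated contexts *)

Lemma clos_rt_map {A B : Type} (R : A -> A -> Prop) (Q : B -> B -> Prop)
    (h : A -> B) :
  (forall x y, R x y -> Q (h x) (h y)) ->
  forall x y, clos_refl_trans A R x y -> clos_refl_trans B Q (h x) (h y).
Proof.
  intros HRQ x y H. induction H.
  - now apply rt_step, HRQ.
  - apply rt_refl.
  - eapply rt_trans; eassumption.
Qed.

Lemma root_tm_ren f g t t' :
  root_tm t t' -> root_tm (ren_tm f g t) (ren_tm f g t').
Proof.
  intros [u]. simpl.
  rewrite (ren_tm_comm u idn S f (up_ren g) f g idn S) by reflexivity.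
  constructor.
Qed.

Lemma ren_subst_mu f g c e :
  ren_cmd f g (subst_cmd Var (scons e CoVar) c) =
  subst_cmd Var (scons (ren_ctx f g e) CoVar) (ren_cmd f (up_ren g) c).
Proof.
  erewrite (proj1 (proj2 ren_subst)) by (intros; reflexivity).
  symmetry. apply subst_ren; [reflexivity|]. now intros [|a].
Qed.

Lemma ren_subst_tmu f g c t :
  ren_cmd f g (subst_cmd (scons t Var) CoVar c) =
  subst_cmd (scons (ren_tm f g t) Var) CoVar (ren_cmd (up_ren f) g c).
Proof.
  erewrite (proj1 (proj2 ren_subst)) by (intros; reflexivity).
  symmetry. apply subst_ren; [|reflexivity]. now intros [|x].
Qed.

Lemma root_cmd_ren f g c c' :
  root_cmd c c' -> root_cmd (ren_cmd f g c) (ren_cmd f g c').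
Proof.
  intros [u t e|d e|t d]; simpl.
  - rewrite (ren_ctx_comm e S idn (up_ren f) g f g S idn) by reflexivity.
    constructor.
  - rewrite ren_subst_mu. constructor.
  - rewrite ren_subst_tmu. constructor.
Qed.

Lemma lin_root_cmd_ren f g c c' :
  lin_root_cmd c c' -> lin_root_cmd (ren_cmd f g c) (ren_cmd f g c').
Proof.
  intros [u t e|d e Hlin|t d Hlin]; simpl.
  - rewrite (ren_ctx_comm e S idn (up_ren f) g f g S idn) by reflexivity.
    constructor.
  - rewrite ren_subst_mu. constructor.
    destruct Hlin as [[a ->]|Hocc]; [left; simpl; eauto|right].
    rewrite (proj1 (proj2 occ_covar_ren) d f (up_ren g) 0 0);
      auto using up_ren_0.
  - rewrite ren_subst_tmu. constructor.
    destruct Hlin as [[x ->]|Hocc]; [left; simpl; eauto|right].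
    rewrite (proj1 (proj2 occ_var_ren) d (up_ren f) g 0 0); auto using up_ren_0.
Qed.

Lemma compat_ren (RT : tm -> tm -> Prop) (RC : cmd -> cmd -> Prop) :
  (forall f g t t', RT t t' -> RT (ren_tm f g t) (ren_tm f g t')) ->
  (forall f g c c', RC c c' -> RC (ren_cmd f g c) (ren_cmd f g c')) ->
  (forall t t', compat_tm RT RC t t' ->
     forall f g, compat_tm RT RC (ren_tm f g t) (ren_tm f g t')) /\
  (forall c c', compat_cmd RT RC c c' ->
     forall f g, compat_cmd RT RC (ren_cmd f g c) (ren_cmd f g c')) /\
  (forall e e', compat_ctx RT RC e e' ->
     forall f g, compat_ctx RT RC (ren_ctx f g e) (ren_ctx f g e')).
Proof.
  intros HT HC.
  apply compat_ind; intros; simpl;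
    auto using compat_tm_root, compat_lam, compat_mu, compat_cmd_root,
      compat_cutl, compat_cutr, compat_pushl, compat_pushr, compat_tmu.
Qed.

(** The application clause of the translation, detached from source terms so
    that its subterms can be renamed, substituted and reduced in the target. *)
Definition app (u v : tm) : tm :=
  Mu (Cut (ren_tm idn S v)
          (TMu (Cut (ren_tm S S u) (Push (Var 0) (CoVar 0))))).

(** [app] weakens both subterms, hence the hypotheses on renaming. *)
Lemma compat_rt_app (RT : tm -> tm -> Prop) (RC : cmd -> cmd -> Prop)
    u u' v v' :
  (forall f g t t', RT t t' -> RT (ren_tm f g t) (ren_tm f g t')) ->
  (forall f g c c', RC c c' -> RC (ren_cmd f g c) (ren_cmd f g c')) ->
  clos_refl_trans tm (compat_tm RT RC) u u' ->
  clos_refl_trans tm (compat_tm RT RC) v v' ->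
  clos_refl_trans tm (compat_tm RT RC) (app u v) (app u' v').
Proof.
  intros HT HC Hu Hv. apply rt_trans with (app u' v).
  - revert Hu. apply (clos_rt_map _ _ (fun w => app w v)). intros x y H.
    now apply compat_mu, compat_cutr, compat_tmu, compat_cutl, compat_ren.
  - revert Hv. apply (clos_rt_map _ _ (fun w => app u' w)). intros x y H.
    now apply compat_mu, compat_cutl, compat_ren.
Qed.

Lemma reds_app u u' v v' :
  reds_tm u u' -> reds_tm v v' -> reds_tm (app u v) (app u' v').
Proof. apply compat_rt_app; auto using root_tm_ren, root_cmd_ren. Qed.

Lemma lin_reds_app u u' v v' :
  lin_reds_tm u u' -> lin_reds_tm v v' -> lin_reds_tm (app u v) (app u' v').
Proof. apply compat_rt_app; auto using root_tm_ren, lin_root_cmd_ren. Qed.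

Lemma compat_rt_lam RT RC t t' :
  clos_refl_trans tm (compat_tm RT RC) t t' ->
  clos_refl_trans tm (compat_tm RT RC) (Lam t) (Lam t').
Proof. apply clos_rt_map. intros. now apply compat_lam. Qed.

Lemma compat_rt_mu RT RC c c' :
  clos_refl_trans cmd (compat_cmd RT RC) c c' ->
  clos_refl_trans tm (compat_tm RT RC) (Mu c) (Mu c').
Proof. apply clos_rt_map. intros. now apply compat_mu. Qed.

Lemma compat_rt_cutl RT RC t t' e :
  clos_refl_trans tm (compat_tm RT RC) t t' ->
  clos_refl_trans cmd (compat_cmd RT RC) (Cut t e) (Cut t' e).
Proof.
  apply (clos_rt_map _ _ (fun w => Cut w e)). intros. now apply compat_cutl.
Qed.

(** * The translation and renaming *)

Lemma ren_app f g u v :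
  ren_tm f g (app u v) = app (ren_tm f g u) (ren_tm f g v).
Proof.
  unfold app. simpl. do 2 f_equal; [|do 2 f_equal];
    now apply ren_tm_comm.
Qed.

Lemma dag_ren :
  (forall t f g, dag_tm (lren_tm f g t) = ren_tm f g (dag_tm t)) /\
  (forall c f g, dag_cmd (lren_cmd f g c) = ren_cmd f g (dag_cmd c)).
Proof.
  apply lexpr_ind; intros; simpl; try (f_equal; auto; fail).
  fold (app (dag_tm (lren_tm f g t)) (dag_tm (lren_tm f g u))).
  rewrite H, H0. symmetry. apply ren_app.
Qed.

Lemma dag_ren_ctx e f g :
  dag_ctx (lren_ctx f g e) = ren_ctx f g (dag_ctx e).
Proof.
  induction e; simpl.
  - reflexivity.
  - rewrite (proj1 dag_ren). do 2 f_equal. now apply ren_tm_comm.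
  - rewrite (proj1 dag_ren), IHe. reflexivity.
Qed.

(** * The translation and substitution *)

(** Cutting a translated application against a context exposes the argument:
    the outer mu of [app] binds a single occurrence. *)
Lemma lin_root_app u v e :
  lin_root_cmd (Cut (app u v) e)
    (Cut v (TMu (Cut (ren_tm S idn u) (Push (Var 0) (ren_ctx S idn e))))).
Proof.
  assert (E : Cut v (TMu (Cut (ren_tm S idn u)
                              (Push (Var 0) (ren_ctx S idn e)))) =
              subst_cmd Var (scons e CoVar)
                (Cut (ren_tm idn S v)
                   (TMu (Cut (ren_tm S S u) (Push (Var 0) (CoVar 0)))))).
  { simpl. f_equal.
    - symmetry. now apply subst_ren_id_tm.
    - do 2 f_equal. symmetry. apply subst_ren_is_ren_tm; reflexivity. }
  rewrite E. constructor. right. simpl.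
  rewrite (proj1 occ_covar_fresh v), (proj1 occ_covar_fresh u) by lia.
  reflexivity.
Qed.

(** Once the argument meets the mu-tilde that awaits it, it is pushed on the
    stack; the mu-tilde binds a single occurrence. *)
Lemma lin_root_push u v e :
  lin_root_cmd
    (Cut v (TMu (Cut (ren_tm S idn u) (Push (Var 0) (ren_ctx S idn e)))))
    (Cut u (Push v e)).
Proof.
  assert (E : Cut u (Push v e) =
              subst_cmd (scons v Var) CoVar
                (Cut (ren_tm S idn u) (Push (Var 0) (ren_ctx S idn e)))).
  { simpl. f_equal.
    - symmetry. now apply subst_ren_id_tm.
    - f_equal. symmetry.
      rewrite (subst_ren_is_ren_ctx e S idn (scons v Var) CoVar idn idn)
        by reflexivity.
      now apply ren_id. }
  rewrite E. constructor. right. simpl.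
  rewrite (proj1 occ_var_fresh u), (proj2 (proj2 occ_var_fresh) e) by lia.
  reflexivity.
Qed.

(** Plugging builds applications around [t] that the target immediately unfolds
    into a context; each unfolding consumes only linear binders. *)
Lemma lin_reds_dag_lplug e :
  forall t, lin_reds_cmd (dag_cmd (lplug e t)) (Cut (dag_tm t) (dag_ctx e)).
Proof.
  induction e as [a|b u|u h IH]; intros t; simpl.
  - apply rt_refl.
  - apply rt_step, compat_cmd_root, (lin_root_app _ _ (CoVar b)).
  - eapply rt_trans; [apply IH|].
    eapply rt_trans; apply rt_step, compat_cmd_root.
    + apply lin_root_app.
    + apply lin_root_push.
Qed.

Lemma subst_app s r u v :
  subst_tm s r (app u v) = app (subst_tm s r u) (subst_tm s r v).
Proof.
  unfold app. simpl. do 2 f_equal; [|do 2 f_equal];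
    apply subst_ren_comm_tm; intros; simpl; auto; now apply ren_ren.
Qed.

(** The translation commutes with every clause of substitution except the one
    for a named term, where the source plugs and the target cuts; there
    [lin_reds_dag_lplug] closes the gap. *)
Lemma lin_reds_dag_subst :
  (forall t s r s' r',
     (forall x, dag_tm (s x) = s' x) -> (forall a, dag_ctx (r a) = r' a) ->
     lin_reds_tm (dag_tm (lsubst_tm s r t)) (subst_tm s' r' (dag_tm t))) /\
  (forall c s r s' r',
     (forall x, dag_tm (s x) = s' x) -> (forall a, dag_ctx (r a) = r' a) ->
     lin_reds_cmd (dag_cmd (lsubst_cmd s r c)) (subst_cmd s' r' (dag_cmd c))).
Proof.
  apply lexpr_ind.
  - intros x s r s' r' Hs Hr. simpl. rewrite Hs. apply rt_refl.
  - intros t IH s r s' r' Hs Hr. simpl. apply compat_rt_lam, IH.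
    + intros [|x]; simpl; [reflexivity|]. now rewrite (proj1 dag_ren), Hs.
    + intros a. now rewrite dag_ren_ctx, Hr.
  - intros t IHt u IHu s r s' r' Hs Hr.
    change (lin_reds_tm
              (app (dag_tm (lsubst_tm s r t)) (dag_tm (lsubst_tm s r u)))
              (subst_tm s' r' (app (dag_tm t) (dag_tm u)))).
    rewrite subst_app. apply lin_reds_app; auto.
  - intros c IH s r s' r' Hs Hr. simpl. apply compat_rt_mu, IH.
    + intros x. now rewrite (proj1 dag_ren), Hs.
    + intros [|a]; simpl; [reflexivity|]. now rewrite dag_ren_ctx, Hr.
  - intros a t IH s r s' r' Hs Hr. simpl.
    eapply rt_trans; [apply lin_reds_dag_lplug|].
    rewrite Hr. now apply compat_rt_cutl, IH.
Qed.

(** * Simulation of the source rules *)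

(** Beta, the administrative cut of the bound variable against its mu-tilde, the
    substitution itself, and theta to discard the mu of the application. *)
Lemma reds_app_lam u t :
  reds_tm (app (Lam u) t) (subst_tm (scons t Var) CoVar u).
Proof.
  unfold app. simpl.
  eapply rt_trans.
  { apply rt_step, compat_mu, compat_cutr, compat_tmu, compat_cmd_root,
      root_beta. }
  eapply rt_trans.
  { apply rt_step, compat_mu, compat_cutr, compat_tmu, compat_cmd_root,
      root_tmu. }
  simpl.
  (* Weakening by y and then using y as the new name of the bound variable
     leaves, after y is rebound, only the weakening by b. *)
  rewrite (subst_ren_is_ren_tm u (up_ren S) S (scons (Var 0) Var) CoVar idn S)
    by (intros [|x]; reflexivity).
  eapply rt_trans.
  { apply rt_step, compat_mu, compat_cmd_root, root_tmu. }
  simpl.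
  rewrite (subst_ren_comm_tm u idn S (scons t Var) CoVar)
    by (try intros [|x]; reflexivity).
  apply rt_step, compat_tm_root, root_theta.
Qed.

(** The mu-tilde step completes the stack, which the mu then captures. *)
Lemma reds_app_mu c t :
  reds_tm (app (Mu c) t)
    (Mu (subst_cmd Var
           (scons (Push (ren_tm idn S t) (CoVar 0)) (fun a => CoVar (S a))) c)).
Proof.
  eapply rt_trans.
  { apply rt_step, compat_mu, compat_cmd_root, root_tmu. }
  apply rt_step, compat_mu.
  cbn [subst_cmd subst_ctx scons].
  rewrite (subst_ren_is_ren_tm (Mu c) S S (scons (ren_tm idn S t) Var) CoVar
             idn S) by reflexivity.
  simpl.
  erewrite <- (proj1 (proj2 subst_ren) c (fun x => x) (up_ren S)).
  - apply compat_cmd_root, root_mu.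
  - reflexivity.
  - now intros [|a].
Qed.

(** The translated argument is the active side of the cut, so its mu captures
    the whole mu-tilde context that holds the function. *)
Lemma reds_app_mu' t c :
  reds_tm (app t (Mu c))
    (Mu (subst_cmd Var
           (scons (TMu (Cut (ren_tm S S t) (Push (Var 0) (CoVar 0))))
                  (fun a => CoVar (S a))) c)).
Proof.
  apply rt_step, compat_mu. simpl.
  erewrite <- (proj1 (proj2 subst_ren) c idn (up_ren S)).
  - apply compat_cmd_root, root_mu.
  - reflexivity.
  - now intros [|a].
Qed.

Lemma dag_root_tm g t v :
  lroot_tm g t v ->
  exists u, reds_tm (dag_tm t) u /\ lin_reds_tm (dag_tm v) u.
Proof.
  intros [u w|c w|w c|w]; eexists; split.
  - apply reds_app_lam.
  - apply lin_reds_dag_subst; [now intros [|x]|reflexivity].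
  - apply reds_app_mu.
  - apply compat_rt_mu, lin_reds_dag_subst; [reflexivity|].
    intros [|a]; simpl; [|reflexivity]. now rewrite (proj1 dag_ren).
  - apply reds_app_mu'.
  - apply compat_rt_mu, lin_reds_dag_subst; [reflexivity|].
    intros [|a]; simpl; [|reflexivity]. rewrite (proj1 dag_ren).
    do 2 f_equal. now apply ren_ren.
  - simpl. rewrite (proj1 dag_ren). apply rt_step, compat_tm_root, root_theta.
  - apply rt_refl.
Qed.

Lemma dag_root_cmd g c d :
  lroot_cmd g c d ->
  exists u, reds_cmd (dag_cmd c) u /\ lin_reds_cmd (dag_cmd d) u.
Proof.
  intros [b c']. eexists; split.
  - apply rt_step, compat_cmd_root, root_mu.
  - apply lin_reds_dag_subst; [reflexivity|now intros [|a]].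
Qed.

Theorem theorem3 :
  forall g : rule,
    (forall t v : ltm, lred_tm g t v ->
       exists u : tm, reds_tm (dag_tm t) u /\ lin_reds_tm (dag_tm v) u) /\
    (forall t v : lcmd, lred_cmd g t v ->
       exists u : cmd, reds_cmd (dag_cmd t) u /\ lin_reds_cmd (dag_cmd v) u).
Proof.
  intros g. apply lred_ind.
  - apply dag_root_tm.
  - intros t v _ (u & Ht & Hv). exists (Lam u).
    split; now apply compat_rt_lam.
  - intros t v w _ (u & Ht & Hv). exists (app u (dag_tm w)).
    split; [apply reds_app|apply lin_reds_app]; auto; apply rt_refl.
  - intros w t v _ (u & Ht & Hv). exists (app (dag_tm w) u).
    split; [apply reds_app|apply lin_reds_app]; auto; apply rt_refl.
  - intros c d _ (u & Hc & Hd). exists (Mu u).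
    split; now apply compat_rt_mu.
  - apply dag_root_cmd.
  - intros a t v _ (u & Ht & Hv). exists (Cut u (CoVar a)).
    split; now apply compat_rt_cutl.
Qed.
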